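(* Let $\kappa$ be a regular infinite cardinal and $\mu$ a singular cardinal with $\mathrm{cf}(\mu)=\kappa$. (1) If $\nu=\mu^{<\mu}$, then $\mathfrak q_\mu(\nu)\le\mathrm{cof}(\mathcal M_\kappa({}^{\mu}\mu,\mu))$. (2) If $\nu=\kappa^{<\mu}$, then $\mathfrak q_\mu(\nu)\le\mathrm{cof}(\mathcal M_\kappa({}^{\mu}2,\mu))$.
   Context: For ordinals $\delta,\rho$, ${}^{\delta}\rho$ is the set of functions $\delta\to\rho$; for a partial function $s\colon\delta\rightharpoonup\rho$, $[s]=\{f\in{}^{\delta}\rho: s\subseteq f\}$. The ${<}\mu$-box topology on ${}^{\delta}\rho$ has base $\{[s]: |\mathrm{dom}(s)|<\mu\}$; $(X,\mu)$ denotes $X$ with it. A set is $\kappa$-meagre if it is a union of at most $\kappa$ nowhere dense sets; $\mathcal M_\kappa(X,\tau)$ is the ideal of $\kappa$-meagre subsets; $\mathrm{cof}(\mathcal I)$ is the least size of $F\subseteq\mathcal I$ such that every $I\in\mathcal I$ is contained in some $J\in F$. For a cardinal $\nu$, $\mathfrak q_\mu(\nu)$ is the least size of a set $Q$ of functions $\nu\to[\mu]^{<\mu}$ such that for every function $g\colon\nu\to[\mu]^{<\mu}$ there is $f\in Q$ with $f(\gamma)\not\subseteq g(\gamma)$ for all $\gamma<\nu$. *)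

(* Defs.v *)
(* Cardinals are represented by types carrying a well-order
   whose proper initial segments are of strictly smaller cardinality
   (i.e. initial ordinals). Sets are predicates. *)
From Stdlib Require Import Classical.

Set Implicit Arguments.

Definition cle (A B : Type) : Prop :=
  exists f : A -> B, forall x y, f x = f y -> x = y.
Definition clt (A B : Type) : Prop := cle A B /\ ~ cle B A.
Definition ceq (A B : Type) : Prop := cle A B /\ cle B A.

Definition is_cardinal (T : Type) (lt : T -> T -> Prop) : Prop :=
  (forall a b c, lt a b -> lt b c -> lt a c) /\
  (forall a, ~ lt a a) /\
  (forall a b, lt a b \/ a = b \/ lt b a) /\
  well_founded lt /\
  (forall a, clt {b | lt b a} T).

Definition cofinal (T : Type) (lt : T -> T -> Prop) (X : T -> Prop) : Prop :=
  forall a, exists b, X b /\ ~ lt b a.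

Definition cf_is (T : Type) (lt : T -> T -> Prop) (K : Type) : Prop :=
  (exists X, cofinal lt X /\ ceq {x | X x} K) /\
  (forall X, cofinal lt X -> cle K {x | X x}).

Definition regular_infinite (K : Type) (ltK : K -> K -> Prop) : Prop :=
  cle nat K /\ cf_is ltK K.

Definition singular (M : Type) (ltM : M -> M -> Prop) : Prop :=
  cle nat M /\ exists X, cofinal ltM X /\ clt {x | X x} M.

Definition small (M : Type) (D : M -> Prop) : Prop := clt {x | D x} M.

(* ^{<mu} R : the set of functions alpha -> R for alpha < mu *)
Definition lessfun (M : Type) (ltM : M -> M -> Prop) (R : Type) : Type :=
  {a : M & {b | ltM b a} -> R}.

Section Box.
Variables (M R : Type).

(* [s] for the partial function s = h restricted to D *)
Definition basic (D : M -> Prop) (h : M -> R) : (M -> R) -> Prop :=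
  fun f => forall x, D x -> f x = h x.

Definition box_closure (A : (M -> R) -> Prop) : (M -> R) -> Prop :=
  fun f => forall D h, small D -> basic D h f -> exists g, basic D h g /\ A g.

Definition box_interior (C : (M -> R) -> Prop) : (M -> R) -> Prop :=
  fun f => exists D h, small D /\ basic D h f /\ forall g, basic D h g -> C g.

Definition box_nowhere_dense (A : (M -> R) -> Prop) : Prop :=
  forall f, ~ box_interior (box_closure A) f.

Definition kmeagre (K : Type) (A : (M -> R) -> Prop) : Prop :=
  exists (I : Type) (N : I -> (M -> R) -> Prop),
    cle I K /\ (forall i, box_nowhere_dense (N i)) /\
    (forall f, A f <-> exists i, N i f).

Definition meagre_cofinal_family (K : Type) (F : ((M -> R) -> Prop) -> Prop) : Prop :=
  (forall A, F A -> kmeagre K A) /\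
  (forall A, kmeagre K A -> exists J, F J /\ forall f, A f -> J f).
End Box.

Definition q_family (N M : Type) (Q : (N -> (M -> Prop)) -> Prop) : Prop :=
  (forall f, Q f -> forall g, small (f g)) /\
  (forall g : N -> (M -> Prop), (forall c, small (g c)) ->
     exists f, Q f /\ forall c, ~ (forall x, f c x -> g c x)).

(* Main.v *)
From Stdlib Require Import Classical ClassicalEpsilon FunctionalExtensionality
  PropExtensionality ProofIrrelevance Cantor List.
From mathcomp Require classical_sets.
Require Import Defs.

Set Implicit Arguments.

(* Let A be the union of nowhere dense sets N_i, i < kappa. Starting from codes
   y_0, y_1, ... in nu, build an increasing run of small conditions: stage i adds a tag
   writing y_i into a column of mu that no earlier stage has touched, and then escapes
   N_i. Let f(A, sigma) send y to the domain of the condition obtained when y is the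
   next code after the history sigma, which has length below kappa and is itself coded
   by an element of nu.

   Given g, the set of all x from which one can read codes y_0, y_1, ... along columns,
   the i-th column being a canonical one avoiding the g(y_j) with j < i, is nowhere
   dense, hence contained in some A of the cofinal family. If each f(A, sigma) had a
   value f(A, sigma)(y) inside g(y), taking these y as successive codes would produce a
   run whose limit lies in that set but outside A. So some f(A, sigma) is nowhere
   below g.

   There are |F| * nu functions f(A, sigma), and nu <= |F| by a diagonal argument, so
   they number at most |F| because |F| * |F| = |F|. *)

(** * Choice, well-founded recursion and Zorn's lemma *)

Lemma pred_ext (T : Type) (P Q : T -> Prop) : (forall t, P t <-> Q t) -> P = Q.
Proof.
  intros H; extensionality t; apply propositional_extensionality, H.
Qed.

Lemma choice_fun (A B : Type) (R : A -> B -> Prop) :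
  (forall a, exists b, R a b) -> exists f, forall a, R a (f a).
Proof.
  intros H.
  exists (fun a => proj1_sig (constructive_indefinite_description _ (H a))).
  intros a; apply proj2_sig.
Qed.

Lemma choice_on (A B : Type) (P : A -> Prop) (R : A -> B -> Prop) (b0 : B) :
  (forall a, P a -> exists b, R a b) -> exists f, forall a, P a -> R a (f a).
Proof.
  intros H; apply (choice_fun (fun a b => P a -> R a b)); intros a.
  destruct (classic (P a)) as [Pa | nPa].
  - destruct (H a Pa) as [b Hb]; exists b; auto.
  - exists b0; tauto.
Qed.

Lemma wf_least (A : Type) (lt : A -> A -> Prop) (P : A -> Prop) :
  well_founded lt -> (exists a, P a) -> exists a, P a /\ forall b, lt b a -> ~ P b.
Proof.
  intros wf [a Pa]; revert Pa; induction a as [a IH] using (well_founded_ind wf).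
  intros Pa; destruct (classic (exists b, lt b a /\ P b)) as [[b [ba Pb]] | N].
  - exact (IH b ba Pb).
  - exists a; split; auto; intros b ba Pb; apply N; eauto.
Qed.

(* Recursion in which the step [Psi] receives a total function but may only
   look at its values below the current index. *)
Lemma wf_recursion (A T : Type) (lt : A -> A -> Prop) (t0 : T)
    (Psi : A -> (A -> T) -> T) :
  well_founded lt ->
  (forall i u v, (forall j, lt j i -> u j = v j) -> Psi i u = Psi i v) ->
  exists u, forall i, u i = Psi i u.
Proof.
  intros wf Hloc.
  set (F := fun i (rec : forall j, lt j i -> T) =>
    Psi i (fun j => match excluded_middle_informative (lt j i) with
                    | left H => rec j H | right _ => t0 end)).
  exists (Fix wf (fun _ => T) F); intros i.
  rewrite Fix_eq.
  - unfold F at 1; apply Hloc; intros j Hj.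
    destruct (excluded_middle_informative (lt j i)); tauto.
  - intros k f g Hfg; unfold F; apply Hloc; intros j Hj.
    destruct (excluded_middle_informative (lt j k)); auto.
Qed.

(** [Zorn_bigcup] also asks about the union of the empty chain, so it is applied to the property
    weakened to admit the empty set. A maximal empty set must equal [X0], since [X0] extends it. *)
Lemma zorn_sets (T : Type) (P : (T -> Prop) -> Prop) (X0 : T -> Prop) :
  P X0 ->
  (forall C : (T -> Prop) -> Prop,
     (exists X, C X) -> (forall X, C X -> P X) ->
     (forall X Y, C X -> C Y -> (forall t, X t -> Y t) \/ (forall t, Y t -> X t)) ->
     P (fun t => exists X, C X /\ X t)) ->
  exists X, P X /\ (forall t, X0 t -> X t) /\
    forall Y, P Y -> (forall t, X t -> Y t) -> forall t, Y t -> X t.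
Proof.
  intros P0 HC.
  destruct (@classical_sets.Zorn_bigcup T
    (fun X => (P X /\ forall t, X0 t -> X t) \/ X = fun _ => False)) as [X [HX mX]].
  - intros C CP tot.
    set (C' := fun X => C X /\ P X /\ forall t, X0 t -> X t).
    assert (E : classical_sets.bigcup C (fun X => X) = fun t => exists X, C' X /\ X t).
    { apply pred_ext; intros t; split.
      - intros [X CX Xt]; exists X; split; auto; split; auto.
        destruct (CP X CX) as [H | H]; [exact H | subst; destruct Xt].
      - intros [X [[CX _] Xt]]; exists X; auto. }
    rewrite E.
    destruct (classic (exists X, C' X)) as [ne | em].
    + left; split.
      * apply HC; auto.
        { intros X [_ [H _]]; exact H. }
        intros X Y [CX _] [CY _]; exact (tot X Y CX CY).
      * destruct ne as [X CX]; intros t Xt; exists X; split; auto.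
        destruct CX as [_ [_ H]]; auto.
    + right; apply pred_ext; intros t; split; [| tauto].
      intros [X [CX _]]; apply em; eauto.
  - assert (mX' : forall Y, P Y -> (forall t, X0 t -> Y t) ->
        (forall t, X t -> Y t) -> forall t, Y t -> X t).
    { intros Y PY Y0 XY; apply NNPP; intros n; apply (mX Y); [split |]; auto. }
    exists X; destruct HX as [[PX X0X] | EX].
    + repeat split; auto.
      intros Y PY XY; apply mX'; auto.
    + assert (E0 : X = X0).
      { apply pred_ext; intros t; split.
        - rewrite EX; tauto.
        - apply mX'; auto; rewrite EX; tauto. }
      subst X0; repeat split; auto.
      intros Y PY XY; apply mX'; auto.
Qed.

(** * Cardinal arithmetic *)

Lemma cle_refl (A : Type) : cle A A.
Proof. exists (fun x => x); auto. Qed.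

Lemma cle_trans (A B C : Type) : cle A B -> cle B C -> cle A C.
Proof. intros [f Hf] [g Hg]; exists (fun x => g (f x)); auto. Qed.

Lemma cle_of_rel (A B : Type) (R : A -> B -> Prop) :
  (forall a, exists b, R a b) ->
  (forall a a' b, R a b -> R a' b -> a = a') -> cle A B.
Proof.
  intros H inj; destruct (choice_fun R H) as [f Hf].
  exists f; intros x y E; apply (inj x y (f x)); auto; rewrite E; auto.
Qed.

Lemma cle_sub_rel (A B : Type) (P : A -> Prop) (Q : B -> Prop) (R : A -> B -> Prop) :
  (forall a, P a -> exists b, Q b /\ R a b) ->
  (forall a a' b, P a -> P a' -> R a b -> R a' b -> a = a') ->
  cle {a | P a} {b | Q b}.
Proof.
  intros H inj.
  apply (cle_of_rel (fun (a : {a | P a}) (b : {b | Q b}) => R (proj1_sig a) (proj1_sig b))).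
  - intros [a Pa]; destruct (H a Pa) as [b [Qb Rab]]; exists (exist _ b Qb); auto.
  - intros [a Pa] [a' Pa'] [b Qb]; simpl; intros R1 R2.
    apply subset_eq_compat; eauto.
Qed.

Lemma cle_sub (A : Type) (P Q : A -> Prop) :
  (forall a, P a -> Q a) -> cle {a | P a} {a | Q a}.
Proof.
  intros H; apply (cle_sub_rel P Q (fun a b => a = b)); intros; subst; eauto.
Qed.

Lemma cle_sub_full (A : Type) (P : A -> Prop) : cle {a | P a} A.
Proof.
  exists (fun a => proj1_sig a); intros [x Px] [y Py]; simpl; apply subset_eq_compat.
Qed.

Lemma cle_prod (A B A' B' : Type) : cle A A' -> cle B B' -> cle (A * B) (A' * B').
Proof.
  intros [f Hf] [g Hg]; exists (fun u => (f (fst u), g (snd u))).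
  intros [a b] [a' b']; simpl; intros E; injection E; intros E2 E1.
  rewrite (Hf _ _ E1), (Hg _ _ E2); auto.
Qed.

(** A maximal partial injection between [A] and [B] is total on one side; otherwise a pair of
    unmatched points could be added. *)
Lemma cle_total (A B : Type) : cle A B \/ cle B A.
Proof.
  destruct (@zorn_sets (A * B)
    (fun G => forall a b a' b', G (a, b) -> G (a', b') -> (a = a' <-> b = b'))
    (fun _ => False)) as [G [HG [_ mG]]].
  - tauto.
  - intros C _ HC tot a b a' b' [X [CX Xa]] [Y [CY Ya]].
    destruct (tot X Y CX CY) as [XY | YX].
    + apply (HC Y CY); auto.
    + apply (HC X CX); auto.
  - destruct (classic (forall a, exists b, G (a, b))) as [L | nL].
    { left; apply (cle_of_rel _ L); intros a a' b H1 H2.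
      apply (HG _ _ _ _ H1 H2); auto. }
    destruct (classic (forall b, exists a, G (a, b))) as [Rr | nR].
    { right; apply (cle_of_rel (fun b a => G (a, b)) Rr); intros b b' a H1 H2.
      apply (HG _ _ _ _ H1 H2); auto. }
    exfalso.
    apply not_all_ex_not in nL; destruct nL as [a0 na].
    apply not_all_ex_not in nR; destruct nR as [b0 nb].
    apply na; exists b0.
    apply (mG (fun u => G u \/ u = (a0, b0))); auto.
    intros a b a' b' [H1 | E1] [H2 | E2].
    + apply (HG _ _ _ _ H1 H2).
    + injection E2; intros -> ->; split; intros E; subst; exfalso; eauto.
    + injection E1; intros -> ->; split; intros E; subst; exfalso; eauto.
    + injection E1; injection E2; intros; subst; tauto.
Qed.

(** Zorn's lemma is applied to graphs of injections from [X * X] to [X] with [X] a subset of [A],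
    starting from a copy of [nat]. At a maximal one the complement of [X] embeds in [X], so [A] is
    no larger than [X]. *)
Lemma cle_square (A : Type) : cle nat A -> cle (A * A) A.
Proof.
  intros [nu Hnu].
  destruct (ex_intro (fun f : nat * nat -> nat => forall x y, f x = f y -> x = y)
    Cantor.to_nat to_nat_inj) as [pi Hpi].
  (* The field [X] is read off the diagonal, so it need not be carried beside the graph. *)
  set (fld := fun (G : (A * A) * A -> Prop) a => exists z, G ((a, a), z)).
  set (P := fun G : (A * A) * A -> Prop =>
    (forall a b, fld G a -> fld G b -> exists z, G ((a, b), z)) /\
    (forall a b z, G ((a, b), z) -> fld G a /\ fld G b /\ fld G z) /\
    (forall u u' z z', G (u, z) -> G (u', z') -> (u = u' <-> z = z'))).
  destruct (@zorn_sets ((A * A) * A) P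
    (fun w => exists m n, w = ((nu m, nu n), nu (pi (m, n))))) as [G [PG [G0 mG]]].
  - assert (Fn : forall n, exists z, exists m k,
        (nu n, nu n, z) = ((nu m, nu k), nu (pi (m, k)))) by (intros; eauto).
    split; [| split].
    + intros a b [z [m [n E]]] [z' [m' [n' E']]].
      injection E; injection E'; intros; subst; eauto.
    + intros a b z [m [n E]]; injection E; intros; subst; repeat split; apply Fn.
    + intros u u' z z' [m [n E]] [m' [n' E']]; injection E; injection E'; intros; subst.
      split; intros H.
      * injection H; intros E2 E1; apply Hnu in E1, E2; subst; auto.
      * apply Hnu, Hpi in H; injection H; intros; subst; auto.
  - intros C ne HC tot.
    assert (sub : forall X, C X -> forall a, fld X a ->
        fld (fun t => exists X, C X /\ X t) a).
    { intros X CX a [z Hz]; exists z, X; auto. }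
    assert (two : forall X Y, C X -> C Y -> exists Z, C Z /\
        (forall t, X t -> Z t) /\ (forall t, Y t -> Z t)).
    { intros X Y CX CY; destruct (tot X Y CX CY); [exists Y | exists X]; auto. }
    split; [| split].
    + intros a b [z [X [CX Xz]]] [z' [Y [CY Yz]]].
      destruct (two X Y CX CY) as [Z [CZ [XZ YZ]]].
      destruct (proj1 (HC Z CZ) a b) as [w Hw]; [exists z | exists z' | exists w, Z]; auto.
    + intros a b z [X [CX Xz]].
      destruct (proj1 (proj2 (HC X CX)) a b z Xz) as [H1 [H2 H3]]; repeat split; eauto.
    + intros u u' z z' [X [CX Xz]] [Y [CY Yz]].
      destruct (two X Y CX CY) as [Z [CZ [XZ YZ]]].
      apply (proj2 (proj2 (HC Z CZ)) u u' z z'); auto.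
  - destruct PG as [tot [fldG injG]].
    set (X := fld G).
    assert (Xnu : forall n, X (nu n)).
    { intros n; exists (nu (pi (n, n))); apply G0; eauto. }
    destruct (@choice_on (A * A) A (fun u => X (fst u) /\ X (snd u))
      (fun u z => G (u, z)) (nu 0)) as [p Hp].
    { intros [a b] [Xa Xb]; apply tot; auto. }
    assert (pX : forall a b, X a -> X b -> X (p (a, b))).
    { intros a b Xa Xb; assert (H : G ((a, b), p (a, b))) by (apply Hp; auto).
      apply fldG in H; tauto. }
    assert (pinj : forall a b a' b', X a -> X b -> X a' -> X b' ->
        p (a, b) = p (a', b') -> a = a' /\ b = b').
    { intros a b a' b' Xa Xb Xa' Xb' E.
      assert (H : G ((a, b), p (a, b))) by (apply Hp; auto).
      assert (H' : G ((a', b'), p (a', b'))) by (apply Hp; auto).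
      apply (injG _ _ _ _ H H') in E; injection E; auto. }
    assert (N01 : nu 0 <> nu 1) by (intros E; apply Hnu in E; discriminate).
    destruct (cle_total {a | ~ X a} {a | X a}) as [[f Hf] | [f Hf]].
    (* Pairing with [nu 0] or [nu 1] fits [X] and its complement side by side into [X]. *)
    + assert (AX : cle A {a | X a}).
      { apply (cle_of_rel (fun a (b : {a | X a}) =>
          (X a /\ proj1_sig b = p (nu 0, a)) \/
          exists H : ~ X a, proj1_sig b = p (nu 1, proj1_sig (f (exist _ a H))))).
        - intros a; destruct (classic (X a)) as [Xa | nXa].
          + exists (exist _ _ (pX _ _ (Xnu 0) Xa)); auto.
          + exists (exist _ _ (pX _ _ (Xnu 1) (proj2_sig (f (exist _ a nXa))))).
            right; exists nXa; auto.
        - intros a a' [b Xb]; simpl; intros [[Xa E] | [Xa E]] [[Xa' E'] | [Xa' E']];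
            subst b; apply pinj in E'; auto; try apply proj2_sig; destruct E' as [E1 E2];
            try (exfalso; auto; fail); auto.
          assert (E3 : f (exist _ a Xa) = f (exist _ a' Xa')).
          { destruct (f (exist _ a Xa)), (f (exist _ a' Xa')); simpl in *.
            apply subset_eq_compat; auto. }
          apply Hf in E3; injection E3; auto. }
      assert (XX : cle ({a | X a} * {a | X a}) A).
      { exists (fun u => p (proj1_sig (fst u), proj1_sig (snd u))).
        intros [[a Xa] [b Xb]] [[a' Xa'] [b' Xb']]; simpl; intros E.
        apply pinj in E; auto; destruct E; subst.
        f_equal; apply subset_eq_compat; auto. }
      exact (cle_trans (cle_prod AX AX) XX).
    + (* otherwise [G] extends to the field together with a disjoint copy of it *)
      exfalso.
      set (cp := fun a y => exists H : X a, y = proj1_sig (f (exist _ a H))).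
      assert (cpN : forall a y, cp a y -> ~ X y).
      { intros a y [H ->]; apply proj2_sig. }
      assert (cpX : forall a y, cp a y -> X a) by (intros a y [H _]; auto).
      assert (cptot : forall a, X a -> exists y, cp a y).
      { intros a Xa; eexists; exists Xa; eauto. }
      assert (cpfun : forall a y a' y', cp a y -> cp a' y' -> (a = a' <-> y = y')).
      { intros a y a' y' [H ->] [H' ->]; split; intros E.
        - subst; rewrite (proof_irrelevance _ H H'); auto.
        - assert (E3 : f (exist _ a H) = f (exist _ a' H')).
          { destruct (f (exist _ a H)), (f (exist _ a' H')); simpl in *.
            apply subset_eq_compat; auto. }
          apply Hf in E3; injection E3; auto. }
      set (Z := fun a => X a \/ exists b, cp b a).
      set (code := fun a k => (X a /\ k = p (nu 0, a)) \/
                              exists b, cp b a /\ k = p (nu 1, b)).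
      assert (codeX : forall a k, code a k -> X k).
      { intros a k [[Xa ->] | [b [Hb ->]]]; apply pX; eauto. }
      assert (codetot : forall a, Z a -> exists k, code a k).
      { intros a [Xa | [b Hb]]; eexists; [left | right]; eauto. }
      assert (codeZ : forall a k, code a k -> Z a).
      { intros a k [[Xa ->] | [b [Hb ->]]]; [left | right]; eauto. }
      assert (codeinj : forall a k a' k', code a k -> code a' k' -> (a = a' <-> k = k')).
      { intros a k a' k' [[Xa ->] | [b [Hb ->]]] [[Xa' ->] | [b' [Hb' ->]]].
        - split; intros E; [subst; auto | apply pinj in E; auto; tauto].
        - split; intros E; [subst; exfalso; exact (cpN _ _ Hb' Xa) |].
          apply pinj in E; eauto; tauto.
        - split; intros E; [subst; exfalso; exact (cpN _ _ Hb Xa') |].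
          apply pinj in E; eauto; destruct E as [E _]; symmetry in E; tauto.
        - split; intros E.
          + apply (cpfun _ _ _ _ Hb Hb') in E; subst; auto.
          + apply pinj in E; eauto; apply (cpfun _ _ _ _ Hb Hb'); tauto. }
      (* A new pair is coded inside [X], paired there by [p], and sent to the disjoint copy, so its
         value never collides with an old one. *)
      set (new := fun w : (A * A) * A =>
        ~ (X (fst (fst w)) /\ X (snd (fst w))) /\
        exists k l, code (fst (fst w)) k /\ code (snd (fst w)) l /\
          cp (p (k, l)) (snd w)).
      set (G' := fun w => G w \/ new w).
      assert (newZ : forall a b z, new ((a, b), z) -> Z a /\ Z b /\ Z z).
      { intros a b z [_ [k [l [H1 [H2 H3]]]]]; simpl in *; repeat split; eauto.
        right; eauto. }
      assert (newN : forall u z, new (u, z) -> ~ X z).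
      { intros u z [_ [k [l [_ [_ H]]]]]; eauto. }
      assert (G'tot : forall a b, Z a -> Z b -> exists z, G' ((a, b), z)).
      { intros a b Za Zb; destruct (classic (X a /\ X b)) as [[Xa Xb] | nX].
        - destruct (tot a b Xa Xb) as [z Hz]; exists z; left; auto.
        - destruct (codetot a Za) as [k Hk], (codetot b Zb) as [l Hl].
          destruct (cptot (p (k, l))) as [z Hz]; eauto.
          exists z; right; split; auto; exists k, l; auto. }
      assert (fldG' : forall a, fld G' a <-> Z a).
      { intros a; split.
        - intros [z [H | H]]; [left; exists z; auto | apply newZ in H; tauto].
        - intros Za; apply G'tot; auto. }
      destruct (cptot (nu 0) (Xnu 0)) as [y0 Hy0].
      assert (Zy0 : Z y0) by (right; eauto).
      destruct (G'tot y0 y0 Zy0 Zy0) as [z0 Hz0].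
      assert (H : G ((y0, y0), z0)).
      { apply (mG G'); [| left | ]; auto.
        split; [| split].
        - intros a b; rewrite !fldG'; apply G'tot.
        - intros a b z; rewrite !fldG'; intros [H | H]; [| auto].
          apply fldG in H; unfold Z; tauto.
        - intros u u' z z' [H | H] [H' | H'].
          + exact (injG _ _ _ _ H H').
          + split; intros E; subst; exfalso.
            * destruct u' as [a b]; apply fldG in H; destruct H' as [n _]; apply n; simpl; tauto.
            * destruct u as [a b]; apply fldG in H; apply (newN _ _ H'); tauto.
          + split; intros E; subst; exfalso.
            * destruct u' as [a b]; apply fldG in H'; destruct H as [n _]; apply n; simpl; tauto.
            * destruct u' as [a b]; apply fldG in H'; apply (newN _ _ H); tauto.
          + destruct u as [a b], u' as [a' b'].
            destruct H as [_ [k [l [H1 [H2 H3]]]]], H' as [_ [k' [l' [H1' [H2' H3']]]]].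
            simpl in *; rewrite <- (cpfun _ _ _ _ H3 H3'); split; intros E.
            * injection E; intros E2 E1.
              apply (codeinj _ _ _ _ H1 H1') in E1; apply (codeinj _ _ _ _ H2 H2') in E2.
              subst; auto.
            * apply pinj in E; eauto; destruct E as [E1 E2].
              apply (codeinj _ _ _ _ H1 H1') in E1; apply (codeinj _ _ _ _ H2 H2') in E2.
              subst; auto. }
      apply fldG in H; apply (cpN _ _ Hy0); tauto.
Qed.

Lemma not_cle_nat_bool : ~ cle nat bool.
Proof.
  intros [f Hf].
  assert (H : f 0 = f 1 \/ f 0 = f 2 \/ f 1 = f 2).
  { destruct (f 0), (f 1), (f 2); auto. }
  destruct H as [H | [H | H]]; apply Hf in H; discriminate.
Qed.

(** Folding a list along the pairing is injective among lists of one length, so the length is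
    recorded with the fold. *)
Lemma cle_list (A : Type) : cle nat A -> cle (list A) A.
Proof.
  intros HA; destruct (cle_square HA) as [p Hp].
  assert (a0 : inhabited A) by (destruct HA as [f _]; exact (inhabits (f 0))).
  destruct a0 as [a0].
  set (r := fix r (l : list A) := match l with nil => a0 | cons a l => p (a, r l) end).
  apply (@cle_trans _ (nat * A)).
  - exists (fun l => (length l, r l)).
    induction x as [| a l IH]; intros [| a' l'] E; simpl in E; try discriminate; auto.
    injection E; intros E1 E2; apply Hp in E1; injection E1; intros E3 ->.
    f_equal; apply IH; congruence.
  - exact (cle_trans (cle_prod HA (cle_refl A)) (cle_square HA)).
Qed.

(** * Partial functions as conditions *)

Section Conditions.
Variables (M R : Type).

(* A condition is a partial function from [M] to [R], given by its graph. *)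
Definition dom (s : M -> R -> Prop) (p : M) : Prop := exists r, s p r.

Definition meets (s : M -> R -> Prop) (x : M -> R) : Prop := forall p r, s p r -> x p = r.

Definition condition (s : M -> R -> Prop) : Prop :=
  small (dom s) /\ forall p r r', s p r -> s p r' -> r = r'.

(** Where both are defined [s] wins, so the result is a function even when [s] and [t] disagree. *)
Definition join (s t : M -> R -> Prop) : M -> R -> Prop :=
  fun p r => s p r \/ (~ dom s p /\ t p r).

Lemma condition_point (r0 : R) (s : M -> R -> Prop) :
  condition s -> exists x, meets s x.
Proof.
  intros [_ fs].
  destruct (@choice_on M R (dom s) s r0) as [x Hx]; [auto |].
  exists x; intros p r H; apply (fs p); [apply Hx; exists r |]; auto.
Qed.
End Conditions.

(** * Small subsets of a singular cardinal *)

Section Cardinals.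
Variables (K M : Type) (ltK : K -> K -> Prop) (ltM : M -> M -> Prop).
Hypothesis hK : is_cardinal ltK.
Hypothesis hM : is_cardinal ltM.
Hypothesis hreg : regular_infinite ltK.
Hypothesis hsing : singular ltM.
Hypothesis hcf : cf_is ltM K.

Lemma cle_K_M : cle K M.
Proof.
  destruct hcf as [[X [_ [_ H]]] _]; exact (cle_trans H (cle_sub_full X)).
Qed.

Lemma not_cle_M_K : ~ cle M K.
Proof.
  intros H; destruct hsing as [_ [X [cX [_ nX]]]]; apply nX.
  exact (cle_trans H (proj2 hcf X cX)).
Qed.

Lemma small_of_not_cle (D : M -> Prop) : ~ cle M {x | D x} -> small D.
Proof. intros H; split; auto; apply cle_sub_full. Qed.

Lemma small_cover (A : Type) (D : M -> Prop) (R : A -> M -> Prop) :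
  ~ cle M A -> (forall x, D x -> exists a, R a x) ->
  (forall a x y, R a x -> R a y -> x = y) -> small D.
Proof.
  intros HA tot fn; apply small_of_not_cle; intros H; apply HA, (cle_trans H).
  apply (cle_of_rel (fun (x : {x | D x}) a => R a (proj1_sig x))).
  - intros [x Dx]; exact (tot x Dx).
  - intros [x Dx] [y Dy] a; simpl; intros R1 R2; apply subset_eq_compat; eauto.
Qed.

Lemma small_sub (D E : M -> Prop) : small E -> (forall x, D x -> E x) -> small D.
Proof.
  intros [_ H] DE; apply small_of_not_cle; intros H'; apply H.
  exact (cle_trans H' (cle_sub _ _ DE)).
Qed.

(** Both factors embed in one of [A], [B], [K] that is infinite and does not admit [M], and its
    square is no larger. [K] serves as a floor when the factors are too small. *)
Lemma not_cle_M_prod (A B : Type) : ~ cle M A -> ~ cle M B -> ~ cle M (A * B).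
Proof.
  intros HA HB.
  assert (Z : exists Z, cle A Z /\ cle B Z /\ cle K Z /\ ~ cle M Z).
  { destruct (cle_total A B) as [AB | BA].
    - destruct (cle_total B K) as [BK | KB].
      + exists K; eauto using cle_trans, cle_refl, not_cle_M_K.
      + exists B; auto using cle_refl.
    - destruct (cle_total A K) as [AK | KA].
      + exists K; eauto using cle_trans, cle_refl, not_cle_M_K.
      + exists A; auto using cle_refl. }
  destruct Z as [Z [AZ [BZ [KZ nZ]]]]; intros H; apply nZ, (cle_trans H).
  apply (cle_trans (cle_prod AZ BZ)), cle_square, (cle_trans (proj1 hreg) KZ).
Qed.

(** If nothing lies strictly above the range of [b], that range is cofinal, and cofinality [K]
    forces at least [K] indices. *)
Lemma strict_bound (J : Type) (b : J -> M) :
  ~ cle K J -> exists a, forall j, ltM (b j) a.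
Proof.
  intros HJ; apply NNPP; intros N; apply HJ.
  set (X := fun m => exists j, m = b j).
  assert (cX : cofinal ltM X).
  { intros a; apply NNPP; intros n; apply N; exists a; intros j.
    apply NNPP; intros n'; apply n; exists (b j); split; auto; exists j; auto. }
  apply (cle_trans (proj2 hcf X cX)).
  apply (cle_of_rel (fun (x : {m | X m}) j => proj1_sig x = b j)).
  - intros [x Hx]; exact Hx.
  - intros [x Hx] [y Hy] j; simpl; intros; subst; apply subset_eq_compat; auto.
Qed.

Lemma not_cle_K_bool : ~ cle K bool.
Proof. intros H; exact (not_cle_nat_bool (cle_trans (proj1 hreg) H)). Qed.

Lemma not_cle_K_below (i : K) : ~ cle K {j | ltK j i}.
Proof. destruct hK as [_ [_ [_ [_ H]]]]; apply (H i). Qed.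

Lemma strict_bound2 (a b : M) : exists c, ltM a c /\ ltM b c.
Proof.
  destruct (strict_bound (fun t : bool => if t then a else b) not_cle_K_bool) as [c Hc].
  exists c; split; [apply (Hc true) | apply (Hc false)].
Qed.

Lemma below_small (a : M) : small (fun b => ltM b a).
Proof. destruct hM as [_ [_ [_ [_ H]]]]; apply H. Qed.

Lemma cofinal_map : exists q : K -> M, forall m, exists i, ltM m (q i).
Proof.
  destruct hcf as [[X [cX [[f Hf] _]]] _].
  assert (m0 : inhabited M).
  { destruct hsing as [[h _] _]; exact (inhabits (h 0)). }
  destruct m0 as [m0].
  destruct (choice_fun (fun i m => forall x : {x | X x}, f x = i -> m = proj1_sig x)) as [q Hq].
  { intros i; destruct (classic (exists x, f x = i)) as [[x E] | N].
    - exists (proj1_sig x); intros y E'; f_equal; apply Hf; congruence.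
    - exists m0; intros x E; exfalso; eauto. }
  exists q; intros m.
  (* Cofinality only yields a member that is not below, so it is applied to some [m'] strictly above
     [m]. *)
  destruct (strict_bound2 m m) as [m' [Hm _]], (cX m') as [x [Xx nx]].
  exists (f (exist _ x Xx)); rewrite (Hq _ (exist _ x Xx) eq_refl); simpl.
  destruct hM as [tr [_ [tri _]]].
  destruct (tri x m') as [H | [-> | H]]; [tauto | auto | eauto].
Qed.

(** Otherwise the chosen embeddings of the segments put [M] into [K * A], although [A] does not
    admit [M], and neither does [K] because [M] is singular. *)
Lemma not_all_below_cle (q : K -> M) (A : Type) :
  (forall m, exists i, ltM m (q i)) -> ~ cle M A ->
  exists i, ~ cle {b | ltM b (q i)} A.
Proof.
  intros Hq HA; apply NNPP; intros N.
  assert (N' : forall i, cle {b | ltM b (q i)} A).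
  { intros i; apply NNPP; intros n; apply N; eauto. }
  apply (not_cle_M_prod not_cle_M_K HA).
  set (f := fun i => proj1_sig (constructive_indefinite_description _ (N' i))).
  assert (Hf : forall i x y, f i x = f i y -> x = y).
  { intros i; exact (proj2_sig (constructive_indefinite_description _ (N' i))). }
  apply (cle_of_rel (fun m (u : K * A) =>
    exists H : ltM m (q (fst u)), snd u = f (fst u) (exist _ m H))).
  - intros m; destruct (Hq m) as [i H]; exists (i, f i (exist _ m H)), H; auto.
  - intros m m' [i a] [H E] [H' E']; simpl in *.
    rewrite E in E'; apply Hf in E'; injection E'; auto.
Qed.

Lemma cle_below (A : Type) : ~ cle M A -> exists a, cle A {b | ltM b a}.
Proof.
  intros HA; destruct cofinal_map as [q Hq].
  destruct (not_all_below_cle q Hq HA) as [i Hi]; exists (q i).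
  destruct (cle_total A {b | ltM b (q i)}); tauto.
Qed.

(** Each [D j] embeds in a proper segment of [M]. Fewer than [K] such segments lie below a single
    [c], so the union is covered by [J] times the segment of [c]. *)
Lemma small_union (J : Type) (D : J -> M -> Prop) :
  ~ cle K J -> (forall j, small (D j)) -> small (fun x => exists j, D j x).
Proof.
  intros HJ HD.
  destruct (choice_fun (fun j a => cle {x | D j x} {b | ltM b a})) as [b Hb].
  { intros j; apply cle_below, HD. }
  destruct (strict_bound b HJ) as [c Hc].
  set (f := fun j => proj1_sig (constructive_indefinite_description _ (Hb j))).
  assert (Hf : forall j x y, f j x = f j y -> x = y).
  { intros j; exact (proj2_sig (constructive_indefinite_description _ (Hb j))). }
  assert (HJM : ~ cle M J).
  { intros H; apply HJ, (cle_trans cle_K_M H). }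
  apply (@small_cover (J * {b | ltM b c}) _ (fun u x =>
    exists H : D (fst u) x, proj1_sig (snd u) = proj1_sig (f (fst u) (exist _ x H)))).
  - apply not_cle_M_prod; [auto | apply (below_small c)].
  - intros x [j H]; set (z := f j (exist _ x H)).
    assert (Hz : ltM (proj1_sig z) c).
    { destruct hM as [tr _]; exact (tr _ _ _ (proj2_sig z) (Hc j)). }
    exists (j, exist _ (proj1_sig z) Hz), H; auto.
  - intros [j z] x y [H E] [H' E']; simpl in *.
    rewrite E in E'.
    assert (E2 : f j (exist _ x H) = f j (exist _ y H')).
    { destruct (f j (exist _ x H)), (f j (exist _ y H')); simpl in *.
      apply subset_eq_compat; auto. }
    apply Hf in E2; injection E2; auto.
Qed.

Lemma small_or (D E : M -> Prop) : small D -> small E -> small (fun x => D x \/ E x).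
Proof.
  intros HD HE.
  apply (@small_sub _ (fun x => exists t : bool, (if t then D else E) x)).
  - apply small_union; [exact not_cle_K_bool | intros [|]; auto].
  - intros x [H | H]; [exists true | exists false]; auto.
Qed.

Lemma small_point (a : M) : small (fun x => x = a).
Proof.
  apply (@small_cover bool _ (fun _ x => x = a)).
  - intros H; apply not_cle_K_bool, (cle_trans cle_K_M H).
  - intros x ->; exists true; auto.
  - intros; subst; auto.
Qed.

Lemma small_empty : small (fun _ : M => False).
Proof.
  destruct hsing as [[h _] _].
  apply (@small_sub _ _ (small_point (h 0))); tauto.
Qed.

Lemma small_union_below (i : K) (D : K -> M -> Prop) :
  (forall j, ltK j i -> small (D j)) -> small (fun x => exists j, ltK j i /\ D j x).
Proof.
  intros HD.
  apply (@small_sub _ (fun x => exists j : {j | ltK j i}, D (proj1_sig j) x)).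
  - apply small_union; [apply not_cle_K_below | intros [j Hj]; auto].
  - intros x [j [Hj H]]; exists (exist _ j Hj); auto.
Qed.

Lemma not_cle_M_list_K : ~ cle M (list K).
Proof.
  intros H; apply not_cle_M_K, (cle_trans H), cle_list, hreg.
Qed.

Lemma small_list_below (a : M) (e : list K * M -> M) :
  small (fun x => exists l m, ltM m a /\ x = e (l, m)).
Proof.
  apply (@small_cover (list K * {b | ltM b a}) _
    (fun u x => x = e (fst u, proj1_sig (snd u)))).
  - apply not_cle_M_prod; [exact not_cle_M_list_K | apply (below_small a)].
  - intros x [l [m [H ->]]]; exists (l, exist _ m H); auto.
  - intros; subst; auto.
Qed.

(** Places in [M] as many disjoint columns as [M] has elements, each a copy of [list K * M]. *)
Lemma column_injection : cle (M * (list K * M)) M.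
Proof.
  assert (infM : cle nat M) by apply hsing.
  assert (H : cle (list K * M) M).
  { apply (cle_trans (cle_prod (cle_list (proj1 hreg)) (cle_refl M))).
    apply (cle_trans (cle_prod cle_K_M (cle_refl M))), cle_square, infM. }
  apply (cle_trans (cle_prod (cle_refl M) H)), cle_square, infM.
Qed.

Lemma not_small_of_injection (E : M -> Prop) (f : M -> M) :
  (forall x y, f x = f y -> x = y) -> small E -> exists m, ~ E (f m).
Proof.
  intros Hf [_ HE]; apply NNPP; intros N; apply HE.
  assert (H : forall m, E (f m)) by (intros m; apply NNPP; intros n; apply N; eauto).
  exists (fun m => exist _ (f m) (H m)); intros x y E'; injection E'; auto.
Qed.

(** A function [g] on [A] is carried to [B] along the injection, with the empty set off the image; a
    function escaping it on [B] escapes [g] on [A]. *)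
Lemma q_family_pull (A B : Type) (Q : (B -> (M -> Prop)) -> Prop) :
  cle A B -> q_family Q ->
  exists Q' : (A -> (M -> Prop)) -> Prop, q_family Q' /\ cle {f | Q' f} {f | Q f}.
Proof.
  intros [i Hi] [sQ HQ].
  exists (fun f => exists f', Q f' /\ f = fun a => f' (i a)); split; [split |].
  - intros f [f' [Qf' ->]] a; auto.
  - intros g sg.
    destruct (HQ (fun b x => exists a, i a = b /\ g a x)) as [f [Qf Hf]].
    + intros b; destruct (classic (exists a, i a = b)) as [[a E] | n].
      * apply (@small_sub _ (g a)); auto.
        intros x [a' [E' Hx]]; rewrite (Hi a a'); congruence.
      * apply (@small_sub _ _ small_empty); intros x [a [E _]]; eauto.
    + exists (fun a => f (i a)); split; [eauto |].
      intros a Ha; apply (Hf (i a)); eauto.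
  - apply (cle_sub_rel _ Q (fun f f' => f = fun a => f' (i a))).
    + auto.
    + intros; subst; auto.
Qed.

(** * Nowhere dense sets and runs of conditions *)

Section Topology.
Variable R : Type.
Variables (z o : R).
Hypothesis hzo : z <> o.

Local Notation cond := (M -> R -> Prop).

Lemma condition_join (s t : cond) : condition s -> condition t -> condition (join s t).
Proof.
  intros [ss fs] [st ft]; split.
  - apply (@small_sub _ (fun p => dom s p \/ dom t p)).
    + exact (small_or ss st).
    + intros p [r [H | [_ H]]]; [left | right]; exists r; auto.
  - intros p r r' [H | [n H]] [H' | [n' H']]; eauto; exfalso; [apply n' | apply n]; eexists; eauto.
Qed.

(** Inside the box of [s] some [g] lies outside the closure of [N], hence has a small neighbourhood
    missing [N]. The new condition is [g] restricted to both domains. *)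
Lemma nowhere_dense_extend (N : (M -> R) -> Prop) (s : cond) :
  box_nowhere_dense N -> condition s ->
  exists s', condition s' /\ (forall p r, s p r -> s' p r) /\
    forall x, meets s' x -> ~ N x.
Proof.
  intros HN Hs; destruct (condition_point z Hs) as [h Hh].
  assert (HI : exists g, basic (dom s) h g /\ ~ box_closure N g).
  { apply NNPP; intros n; apply (HN h); exists (dom s), h; split; [apply Hs |].
    split; [intros p _; auto |]; intros g Hg; apply NNPP; intros n'; apply n; eauto. }
  destruct HI as [g [Hg nC]].
  assert (HD : exists D h', small D /\ basic D h' g /\ forall x, basic D h' x -> ~ N x).
  { apply NNPP; intros n; apply nC; intros D h' sD HD; apply NNPP; intros n'.
    apply n; exists D, h'; split; [auto | split; [auto |]]; intros x Hx Nx; apply n'; eauto. }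
  destruct HD as [D [h' [sD [HD av]]]].
  exists (fun p r => (dom s p \/ D p) /\ r = g p); split; [split | split].
  - apply (@small_sub _ (fun p => dom s p \/ D p)).
    + exact (small_or (proj1 Hs) sD).
    + intros p [r [H _]]; auto.
  - intros p r r' [_ H] [_ H']; congruence.
  - intros p r H; assert (Hp : dom s p) by (exists r; auto); split; auto.
    rewrite (Hg p Hp), (Hh p r H); auto.
  - intros x Hx; apply av; intros p Dp.
    rewrite <- (HD p Dp); apply Hx; auto.
Qed.

(** [D'] need not contain [D]: the point [h'] lies in the given box, and its neighbourhood fixed on
    [D'] misses [N]. *)
Lemma nowhere_dense_intro (N : (M -> R) -> Prop) :
  (forall D h, small D -> exists D' h', small D' /\ (forall p, D p -> h' p = h p) /\
     forall x, basic D' h' x -> ~ N x) ->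
  box_nowhere_dense N.
Proof.
  intros H f [D [h [sD [_ HD]]]].
  destruct (H D h sD) as [D' [h' [sD' [E av]]]].
  destruct (HD h' E D' h' sD') as [x [Hx Nx]]; [intros p _; auto |].
  exact (av x Hx Nx).
Qed.

Section Runs.
Variables (N : K -> (M -> R) -> Prop) (ext : K -> cond -> cond).
Hypothesis ext_condition : forall i s, condition s -> condition (ext i s).
Hypothesis ext_extends : forall i s, condition s -> forall p r, s p r -> ext i s p r.
Hypothesis ext_avoids : forall i s, condition s -> forall x, meets (ext i s) x -> ~ N i x.

Definition before (i : K) (u : K -> cond) : cond := fun p r => exists j, ltK j i /\ u j p r.

Definition is_run (t u : K -> cond) : Prop :=
  forall i, u i = ext i (join (before i u) (t i)).

Lemma before_local (i : K) (u v : K -> cond) :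
  (forall j, ltK j i -> u j = v j) -> before i u = before i v.
Proof.
  intros H; extensionality p; apply pred_ext; intros r.
  split; intros [j [Hj E]]; exists j; [rewrite <- H | rewrite H]; auto.
Qed.

Lemma run_exists (t : K -> cond) : exists u, is_run t u.
Proof.
  apply (@wf_recursion K cond ltK (fun _ _ => False)
    (fun i u => ext i (join (before i u) (t i)))).
  - apply hK.
  - intros i u v H; rewrite (before_local _ _ H); auto.
Qed.

(** Lets the run of a decoded history stand in for the run under construction. *)
Lemma run_local (t t' u u' : K -> cond) (i : K) :
  is_run t u -> is_run t' u' -> (forall j, ltK j i -> t j = t' j) ->
  before i u = before i u'.
Proof.
  intros Hu Hu' Ht.
  assert (tr := proj1 hK).
  apply before_local; intros j.
  assert (wf : well_founded ltK) by apply hK.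
  induction j as [j IH] using (well_founded_ind wf); intros Hj.
  rewrite Hu, Hu', Ht; auto; f_equal; f_equal; apply before_local; eauto.
Qed.

(** Fewer than [K] stages precede [i], so their domains have a small union; as the stages increase,
    they agree on common points. *)
Lemma run_condition (t u : K -> cond) (i : K) :
  is_run t u -> (forall j, condition (t j)) ->
  condition (before i u) /\ condition (u i) /\
  (forall p r, before i u p r -> u i p r) /\
  (forall p r, ~ dom (before i u) p -> t i p r -> u i p r) /\
  (forall x, meets (u i) x -> ~ N i x).
Proof.
  intros Hu Ht.
  assert (B : condition (before i u)).
  { assert (wf : well_founded ltK) by apply hK.
    induction i as [i IH] using (well_founded_ind wf).
    assert (C : forall j, ltK j i -> condition (u j)).
    { intros j Hj; rewrite Hu; apply ext_condition, condition_join; auto. }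
    assert (mono : forall j k, ltK j k -> ltK k i -> forall p r, u j p r -> u k p r).
    { intros j k Hjk Hk p r H; rewrite Hu; apply ext_extends.
      - apply condition_join; auto.
      - left; exists j; auto. }
    split.
    - apply (@small_sub _ (fun p => exists j, ltK j i /\ dom (u j) p)).
      + apply small_union_below; intros j Hj; apply C; auto.
      + intros p [r [j [Hj H]]]; exists j; split; auto; exists r; auto.
    - intros p r r' [j [Hj H]] [k [Hk H']].
      destruct (proj1 (proj2 (proj2 hK)) j k) as [L | [E | L]].
      + apply (proj2 (C k Hk) p); eauto.
      + subst; apply (proj2 (C k Hk) p); eauto.
      + apply (proj2 (C j Hj) p); eauto. }
  assert (J : condition (join (before i u) (t i))) by (apply condition_join; auto).
  split; [exact B |].
  rewrite (Hu i); split; [| split; [| split]].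
  - apply ext_condition; auto.
  - intros p r H; apply ext_extends; auto; left; auto.
  - intros p r n H; apply ext_extends; auto; right; auto.
  - apply ext_avoids; auto.
Qed.

Lemma run_limit (t u : K -> cond) :
  is_run t u -> (forall j, condition (t j)) -> exists x, forall i, meets (u i) x.
Proof.
  intros Hu Ht.
  destruct (@choice_on M R (fun p => exists i r, u i p r) (fun p r => exists i, u i p r) z)
    as [x Hx].
  { intros p [i [r H]]; eauto. }
  exists x; intros i p r H.
  destruct (Hx p) as [j Hj]; [eauto |].
  assert (C := fun k => proj1 (proj2 (run_condition k Hu Ht))).
  assert (mono : forall j k, ltK j k -> forall p r, u j p r -> u k p r).
  { intros j' k L p' r' H'; destruct (run_condition k Hu Ht) as [_ [_ [H1 _]]].
    apply H1; exists j'; auto. }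
  destruct (proj1 (proj2 (proj2 hK)) i j) as [L | [E | L]].
  - apply (proj2 (C j) p); eauto.
  - subst; apply (proj2 (C j) p); eauto.
  - apply (proj2 (C i) p); eauto.
Qed.
End Runs.

(* [ext] has small domains even on non-conditions, because the members of the
   family [Q] built from it must take small values everywhere. *)
Lemma escape_exists (N : K -> (M -> R) -> Prop) :
  (forall i, box_nowhere_dense (N i)) ->
  exists ext : K -> cond -> cond, (forall i s, small (dom (ext i s))) /\
    (forall i s, condition s -> condition (ext i s)) /\
    (forall i s, condition s -> forall p r, s p r -> ext i s p r) /\
    (forall i s, condition s -> forall x, meets (ext i s) x -> ~ N i x).
Proof.
  intros HN.
  destruct (choice_fun (fun (v : K * cond) s' => small (dom s') /\
    (condition (snd v) -> condition s' /\ (forall p r, snd v p r -> s' p r) /\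
      forall x, meets s' x -> ~ N (fst v) x))) as [ext Hext].
  - intros [i s]; simpl; destruct (classic (condition s)) as [C | nC].
    + destruct (nowhere_dense_extend (HN i) C) as [s' H].
      exists s'; split; [apply (proj1 H) | auto].
    + exists (fun _ _ => False); split; [| tauto].
      apply (@small_sub _ _ small_empty); intros p [r H]; auto.
  - exists (fun i s => ext (i, s)); split; [| split; [| split]]; intros i s; try intros C;
      destruct (Hext (i, s)) as [H1 H2]; auto; apply H2; auto.
Qed.

(** Indices outside the image of [I] receive the empty set. *)
Lemma kmeagre_indexed (A : (M -> R) -> Prop) : kmeagre K A ->
  exists N : K -> (M -> R) -> Prop, (forall i, box_nowhere_dense (N i)) /\
    forall x, A x -> exists i, N i x.
Proof.
  intros [I [N [[f Hf] [HN HA]]]].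
  exists (fun i x => exists j, f j = i /\ N j x); split.
  - intros i; destruct (classic (exists j, f j = i)) as [[j E] | n].
    + replace (fun x => exists j, f j = i /\ N j x) with (N j); [auto |].
      apply pred_ext; intros x; split; [eauto |].
      intros [j' [E' H]]; rewrite (Hf j j'); congruence.
    + apply nowhere_dense_intro; intros D h sD; exists D, h; split; [auto | split; [auto |]].
      intros x _ [j [E _]]; eauto.
  - intros x Ax; apply HA in Ax; destruct Ax as [j H]; eauto.
Qed.

Lemma nowhere_dense_kmeagre (A : (M -> R) -> Prop) : box_nowhere_dense A -> kmeagre K A.
Proof.
  intros HA; exists unit, (fun _ => A); split; [| split; auto].
  - destruct hreg as [[f _] _]; exists (fun _ => f 0); intros [] []; auto.
  - intros f; split; [exists tt; auto | intros [_ H]; auto].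
Qed.

(** A run is taken with [s] as the tag of every stage. Nothing precedes the least stage, so [s]
    enters it whole, and the limit escapes every nowhere dense set. *)
Lemma baire (A : (M -> R) -> Prop) (s : cond) :
  kmeagre K A -> condition s -> exists x, meets s x /\ ~ A x.
Proof.
  intros HA Cs; destruct (kmeagre_indexed HA) as [N [HN cov]].
  destruct (escape_exists N HN) as [ext [_ [E1 [E2 E3]]]].
  destruct (run_exists ext (fun _ => s)) as [u Hu].
  destruct (run_limit N E1 E2 E3 Hu (fun _ => Cs)) as [x Hx].
  exists x; split.
  - destruct (wf_least (fun _ => True) (proj1 (proj2 (proj2 (proj2 hK))))) as [i [_ Hi]].
    { destruct hreg as [[f _] _]; exists (f 0); auto. }
    intros p r H; apply (Hx i p r).
    destruct (run_condition N E1 E2 E3 i Hu (fun _ => Cs)) as [_ [_ [_ [H1 _]]]].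
    apply H1; auto; intros [r' [j [Hj _]]]; exact (Hi j Hj I).
  - intros Ax; destruct (cov x Ax) as [i Ni].
    destruct (run_condition N E1 E2 E3 i Hu (fun _ => Cs)) as [_ [_ [_ [_ H1]]]].
    exact (H1 x (Hx i) Ni).
Qed.
(** * Tags, traps and the family Q *)

Section Coding.
Variables (e : M * (list K * M) -> M) (q : K -> M) (k0 : K) (m0 : M).
Hypothesis e_inj : forall u v, e u = e v -> u = v.
Hypothesis q_cofinal : forall m, exists i, ltM m (q i).

(* A copy of [R^{<mu}]: a function on [M] vanishing outside a proper initial segment.
   The extra coordinate in [list K] absorbs sequences of codes of length below [K]
   (prepend the index) without any pairing function on [M] that respects initial
   segments. *)
Definition code : Type :=
  {y : list K * M -> R | exists a, forall l m, ~ ltM m a -> y (l, m) = z}.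

Definition mkcode (f : list K * M -> R)
    (H : exists a, forall l m, ~ ltM m a -> f (l, m) = z) : code := exist _ f H.

Variable bd : code -> M.
Hypothesis bd_spec : forall (y : code) l m, ~ ltM m (bd y) -> proj1_sig y (l, m) = z.

(* Each column [e (c, _)] has three tracks, told apart by the length of the list:
   length 0 marks the position [bd y], length 1 is a block of zeros of size [q i],
   and length at least 2 carries the values of [y] below [bd y]. *)
Definition tag_loc (i : K) (y : code) (u : list K * M) : Prop :=
  match fst u with
  | nil => ~ ltM (bd y) (snd u)
  | cons _ nil => ltM (snd u) (q i)
  | _ => ltM (snd u) (bd y)
  end.

(** On the marking track [bd y] is the first position whose value is not [z], so it can be read off
    a point. *)
Definition tag_val (y : code) (u : list K * M) : R :=
  match fst u with
  | nil => if excluded_middle_informative (snd u = bd y) then o else z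
  | cons _ nil => z
  | cons _ (cons _ l) => proj1_sig y (l, snd u)
  end.

Definition tag (i : K) (c : M) (y : code) : M -> R -> Prop :=
  fun p r => exists u, tag_loc i y u /\ p = e (c, u) /\ r = tag_val y u.

Lemma tag_condition (i : K) (c : M) (y : code) : condition (tag i c y).
Proof.
  split.
  - destruct (strict_bound2 (bd y) (q i)) as [a [Ha Ha']].
    destruct hM as [tr [_ [tri _]]].
    apply (@small_sub _ _ (small_list_below a (fun u => e (c, u)))).
    intros p [r [[l m] [L [E _]]]]; exists l, m; split; auto.
    destruct l as [| k [| k' l]]; unfold tag_loc in L; simpl in L; eauto.
    destruct (tri m (bd y)) as [H | [-> | H]]; [eauto | auto | tauto].
  - intros p r r' [u [_ [-> ->]]] [u' [_ [E ->]]].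
    apply e_inj in E; injection E; intros; subst; auto.
Qed.

(** On each column [h1] makes the marking track leave [z] first at [a c]. A tag there must then have
    bound [a c], and the small piece [W c] fixes all values of its code below that bound, leaving
    one possible code. *)
Lemma tag_decode (D : M -> Prop) (h : M -> R) : small D ->
  exists (h1 : M -> R) (W : M -> list K * M -> Prop) (y1 : M -> code),
    (forall p, D p -> h1 p = h p) /\
    (forall c, small (fun p => exists u, W c u /\ p = e (c, u))) /\
    forall c x i y, (forall u, W c u -> x (e (c, u)) = h1 (e (c, u))) ->
      meets (tag i c y) x -> y = y1 c.
Proof.
  intros sD.
  destruct hM as [tr [irr [tri [wf _]]]].
  (* A position is free when its value is not [z] already or can still be chosen; [D] is too small
     to rule out a whole track. *)
  set (free := fun c m => ~ D (e (c, (nil, m))) \/ h (e (c, (nil, m))) <> z).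
  destruct (choice_fun (fun c m => free c m /\ forall m', ltM m' m -> ~ free c m'))
    as [a Ha].
  { intros c; apply (wf_least (free c) wf).
    destruct (@not_small_of_injection D (fun m => e (c, (nil, m)))) as [m Hm]; auto.
    - intros m m' E; apply e_inj in E; injection E; auto.
    - exists m; left; auto. }
  set (h1 := fun p => if excluded_middle_informative
      (exists c, p = e (c, (nil, a c)) /\ ~ D p) then o else h p).
  assert (h1D : forall p, D p -> h1 p = h p).
  { intros p Dp; unfold h1; destruct (excluded_middle_informative _) as [[c [_ n]] |]; tauto. }
  assert (h1a : forall c, h1 (e (c, (nil, a c))) <> z).
  { intros c E; destruct (classic (D (e (c, (nil, a c))))) as [d | nd].
    - destruct (Ha c) as [[H | H] _]; [tauto |]; rewrite (h1D _ d) in E; tauto.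
    - unfold h1 in E; destruct (excluded_middle_informative _) as [_ | n]; [auto |].
      apply n; eauto. }
  assert (h1b : forall c m, ltM m (a c) -> h1 (e (c, (nil, m))) = z).
  { intros c m L; destruct (not_or_and _ _ (proj2 (Ha c) m L)) as [nd nz].
    apply NNPP in nd; apply NNPP in nz; rewrite h1D; auto. }
  set (W := fun (c : M) (u : list K * M) => ~ ltM (a c) (snd u)).
  assert (bda : forall c x i y, (forall u, W c u -> x (e (c, u)) = h1 (e (c, u))) ->
      meets (tag i c y) x -> bd y = a c).
  { intros c x i y Hx Ht.
    assert (V : forall m, ~ ltM (bd y) m -> x (e (c, (nil, m))) =
        if excluded_middle_informative (m = bd y) then o else z).
    { intros m L; apply Ht; exists (nil, m); auto. }
    destruct (tri (bd y) (a c)) as [L | [E | L]]; [exfalso | auto | exfalso].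
    - specialize (V _ (irr (bd y))).
      rewrite Hx, h1b in V; auto.
      + destruct (excluded_middle_informative _); auto.
      + intros L'; apply (irr (a c)); eauto.
    - apply (h1a c); rewrite <- Hx; [| apply irr].
      rewrite V; [| intros L'; apply (irr (a c)); eauto].
      destruct (excluded_middle_informative _) as [E |]; auto.
      rewrite E in L; destruct (irr _ L). }
  (* The two points may differ: below [a c] both codes are dictated by [h1] and from there on both
     vanish, so [y1 c] depends on the column alone. *)
  assert (uniq : forall c x x' i i' y y',
      (forall u, W c u -> x (e (c, u)) = h1 (e (c, u))) ->
      (forall u, W c u -> x' (e (c, u)) = h1 (e (c, u))) ->
      meets (tag i c y) x -> meets (tag i' c y') x' -> y = y').
  { intros c x x' i i' y y' Hx Hx' Ht Ht'.
    assert (B := bda _ _ _ _ Hx Ht); assert (B' := bda _ _ _ _ Hx' Ht').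
    destruct y as [f Hf] eqn:Ey, y' as [f' Hf'] eqn:Ey'.
    apply subset_eq_compat; extensionality u; destruct u as [l m].
    rewrite <- Ey in *; rewrite <- Ey' in *.
    replace f with (proj1_sig y) by (rewrite Ey; auto).
    replace f' with (proj1_sig y') by (rewrite Ey'; auto).
    destruct (classic (ltM m (a c))) as [L | nL].
    - assert (w : W c (k0 :: k0 :: l, m)).
      { intros L'; apply (irr m); simpl in L'; eauto. }
      assert (E : x (e (c, (k0 :: k0 :: l, m))) = proj1_sig y (l, m)).
      { apply Ht; exists (k0 :: k0 :: l, m); repeat split; unfold tag_loc; simpl; congruence. }
      assert (E' : x' (e (c, (k0 :: k0 :: l, m))) = proj1_sig y' (l, m)).
      { apply Ht'; exists (k0 :: k0 :: l, m); repeat split; unfold tag_loc; simpl; congruence. }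
      rewrite <- E, <- E', Hx, Hx'; auto.
    - rewrite !bd_spec; congruence. }
  assert (y0 : code) by (exists (fun _ => z), m0; auto).
  destruct (choice_fun (fun c y1 => forall x i y,
    (forall u, W c u -> x (e (c, u)) = h1 (e (c, u))) -> meets (tag i c y) x -> y = y1))
    as [y1 Hy1].
  { intros c.
    destruct (classic (exists x i y, (forall u, W c u -> x (e (c, u)) = h1 (e (c, u))) /\
      meets (tag i c y) x)) as [[x' [i' [y' [Hx' Ht']]]] | n].
    - exists y'; intros x i y Hx Ht; eauto.
    - exists y0; intros x i y Hx Ht; exfalso; apply n; eauto 6. }
  exists h1, W, y1; split; [auto | split; [| auto]].
  intros c; destruct (strict_bound2 (a c) (a c)) as [b [Hb _]].
  apply (@small_sub _ _ (small_list_below b (fun u => e (c, u)))).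
  intros p [[l m] [w ->]]; exists l, m; split; auto.
  unfold W in w; simpl in w.
  destruct (tri m (a c)) as [H | [-> | H]]; [eauto | auto | tauto].
Qed.

(* Given at most [code]-many meagre sets, pick a point outside the [y]-th one that
   carries the tag of [y]: these points form a nowhere dense set. *)
Lemma code_cle_family (F : ((M -> R) -> Prop) -> Prop) :
  meagre_cofinal_family K F -> cle code {A | F A}.
Proof.
  intros [FM Fc].
  destruct (cle_total code {A | F A}) as [H | [f Hf]]; [exact H | exfalso].
  destruct (choice_fun (fun y x => meets (tag k0 m0 y) x /\
    forall A (HA : F A), f (exist _ A HA) = y -> ~ A x)) as [x Hx].
  { intros y; destruct (classic (exists A (HA : F A), f (exist _ A HA) = y))
      as [[A [HA E]] | n].
    - destruct (baire (FM A HA) (tag_condition k0 m0 y)) as [x [Hx nx]].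
      exists x; split; auto; intros A' HA' E'.
      assert (E2 := Hf _ _ (eq_trans E (eq_sym E'))).
      apply (f_equal (@proj1_sig _ _)) in E2; simpl in E2; subst A'; auto.
    - destruct (condition_point z (tag_condition k0 m0 y)) as [x Hx].
      exists x; split; auto; intros A HA E; exfalso; eauto. }
  destruct (Fc (fun w => exists y, w = x y)) as [A [HA sub]].
  - apply nowhere_dense_kmeagre, nowhere_dense_intro; intros D h sD.
    destruct (tag_decode h sD) as [h1 [W [y1 [h1D [sW dec]]]]].
    set (E := fun p => D p \/ exists u, W m0 u /\ p = e (m0, u)).
    assert (sE : small E) by (apply small_or; auto).
    (* On the box over [E] only the point with code [y1 m0] can survive; one more coordinate [b],
       given a value different from its own, excludes it. *)
    destruct (@not_small_of_injection E (fun m => m)) as [b nb]; auto.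
    set (r := if excluded_middle_informative (x (y1 m0) b = z) then o else z).
    assert (Hr : x (y1 m0) b <> r).
    { unfold r; destruct (excluded_middle_informative _); congruence. }
    clearbody r.
    exists (fun p => E p \/ p = b),
      (fun p => if excluded_middle_informative (p = b) then r else h1 p).
    assert (off : forall p, E p -> p <> b) by (intros p Ep ->; auto).
    split; [apply small_or; auto using small_point | split].
    + intros p Dp; destruct (excluded_middle_informative (p = b)) as [-> |]; auto.
      exfalso; apply nb; left; auto.
    + intros w Hw [y ->].
      assert (Ey : y = y1 m0).
      { apply (dec m0 (x y) k0); [| apply Hx].
        intros u wu; assert (Eu : E (e (m0, u))) by (right; eauto).
        rewrite (Hw (e (m0, u))); [| left; exact Eu].
        destruct (excluded_middle_informative _) as [Eb |]; [destruct (off _ Eu Eb) | auto]. }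
      subst y; apply Hr; rewrite (Hw b); auto.
      destruct (excluded_middle_informative _); tauto.
  - apply (proj2 (Hx (f (exist _ A HA))) A HA eq_refl), sub; eauto.
Qed.

(** * The nowhere dense trap *)

Section Trap.
Variable col : (M -> Prop) -> M.
Hypothesis col_fresh : forall E, small E -> forall u, ~ E (e (col E, u)).
Variable g : code -> M -> Prop.
Hypothesis g_small : forall y, small (g y).

(* The second disjunct keeps the columns [c j] distinct. *)
Definition used (i : K) (c : K -> M) (y : K -> code) : M -> Prop :=
  fun p => exists j, ltK j i /\ (g (y j) p \/ p = e (c j, (nil, m0))).

(* Each code read off [x] determines, through [g], the column carrying the next one.
   Since the zero blocks have cofinal sizes, a small condition can spoil one of them;
   this makes the trap nowhere dense. *)
Definition trap (x : M -> R) : Prop :=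
  exists (c : K -> M) (y : K -> code),
    forall i, c i = col (used i c y) /\ meets (tag i (c i) (y i)) x.

Lemma used_local (i : K) (c c' : K -> M) (y y' : K -> code) :
  (forall j, ltK j i -> c j = c' j /\ y j = y' j) -> used i c y = used i c' y'.
Proof.
  intros H; apply pred_ext; intros p; split; intros [j [Hj H']];
    exists j; split; auto; destruct (H j Hj) as [E1 E2]; rewrite E1, E2 in *; auto.
Qed.

Lemma used_small (i : K) (c : K -> M) (y : K -> code) : small (used i c y).
Proof.
  apply small_union_below; intros j _; apply small_or; auto using small_point.
Qed.

(** Fixing the decoding pieces of the columns before stage [i] forces column [c i]. Its zero block
    is too large to lie inside [D], so one position of it can be set to [o]. *)
Lemma trap_nowhere_dense : box_nowhere_dense trap.
Proof.
  apply nowhere_dense_intro; intros D h sD.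
  assert (wfK : well_founded ltK) by apply hK.
  destruct (tag_decode h sD) as [h1 [W [y1 [h1D [sW dec]]]]].
  (* The columns are predicted in advance: stage [j] can only carry the code [y1 (c j)]. *)
  destruct (@wf_recursion K M ltK m0 (fun i c => col (used i c (fun j => y1 (c j)))))
    as [c Hc]; auto.
  { intros i u v H; f_equal; apply used_local; intros j Hj; rewrite H; auto. }
  destruct (not_all_below_cle q q_cofinal (proj2 sD)) as [i Hi].
  assert (HP : exists b, ltM b (q i) /\ ~ D (e (c i, (k0 :: nil, b)))).
  { apply NNPP; intros n; apply Hi.
    apply (cle_sub_rel (fun b => ltM b (q i)) D (fun b p => p = e (c i, (k0 :: nil, b)))).
    - intros b Hb; eexists; split; [| reflexivity]; apply NNPP; intros n'; eauto.
    - intros b b' p _ _ -> E; apply e_inj in E; injection E; auto. }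
  destruct HP as [b [Hb nD]].
  set (pt := e (c i, (k0 :: nil, b))).
  (* Spoiling [pt] must not disturb the decoding of earlier columns, which are distinct from
     [c i]. *)
  assert (dist : forall j u, ltK j i -> e (c j, u) <> pt).
  { intros j u Hj E; apply e_inj in E; injection E; intros _ E'.
    apply (@col_fresh (used i c (fun j => y1 (c j)))) with (u := (nil, m0)).
    - apply used_small.
    - rewrite <- Hc; exists j; split; auto; right; congruence. }
  exists (fun p => (D p \/ p = pt) \/
      exists j, ltK j i /\ exists u, W (c j) u /\ p = e (c j, u)),
    (fun p => if excluded_middle_informative (p = pt) then o else h1 p).
  split; [| split].
  - apply small_or; [apply small_or; auto using small_point |].
    apply small_union_below; auto.
  - intros p Dp; destruct (excluded_middle_informative (p = pt)) as [-> |]; auto; tauto.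
  - intros x Hx [c' [y' H]].
    assert (same : forall j, ltK j i -> c' j = c j /\ y' j = y1 (c j)).
    { intros j; induction j as [j IH] using (well_founded_ind wfK); intros Hj.
      assert (Ec : c' j = c j).
      { rewrite (Hc j), (proj1 (H j)); f_equal; apply used_local; intros k Hk.
        apply IH; auto; destruct hK as [tr _]; eauto. }
      split; auto; apply (dec (c j) x j).
      - intros u wu; rewrite (Hx (e (c j, u))); [| right; eauto].
        destruct (excluded_middle_informative _) as [E |]; auto.
        destruct (dist j u Hj E).
      - rewrite <- Ec; apply H. }
    assert (Ec : c' i = c i).
    { rewrite (Hc i), (proj1 (H i)); f_equal; apply used_local; auto. }
    assert (X1 : x pt = o).
    { rewrite (Hx pt); auto; destruct (excluded_middle_informative _); tauto. }
    assert (X2 : x pt = z).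
    { apply (proj2 (H i)); exists (k0 :: nil, b); rewrite Ec; repeat split; auto. }
    congruence.
Qed.
End Trap.

(** If [E] met every column, choosing a point in each would embed [M] into [E]. *)
Lemma column_chooser : exists col : (M -> Prop) -> M,
  forall E, small E -> forall u, ~ E (e (col E, u)).
Proof.
  apply (@choice_on _ M (fun E => small E) (fun E c => forall u, ~ E (e (c, u))) m0).
  intros E sE; apply NNPP; intros n.
  destruct (choice_fun (fun c u => E (e (c, u)))) as [f Hf].
  { intros c; apply NNPP; intros n'; apply n; exists c; intros u Eu; eauto. }
  destruct (@not_small_of_injection E (fun c => e (c, f c))) as [c Hc]; auto.
  intros c c' H; apply e_inj in H; injection H; auto.
Qed.

(* Initial histories of length below [K] are bounded, so a single code records one. *)
Lemma history_decoder : exists (dc : code -> K -> M) (dy : code -> K -> code),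
  forall i c y, exists s, (forall j, ~ ltK i j -> dc s j = c j) /\
    forall j, ltK j i -> dy s j = y j.
Proof.
  (* [dc] returns the position carrying [o] whenever there is exactly one. *)
  destruct (choice_fun (fun (v : code * K) c =>
    forall m, proj1_sig (fst v) (snd v :: nil, m) = o -> m = c \/
      exists m', m' <> m /\ proj1_sig (fst v) (snd v :: nil, m') = o)) as [dc Hdc].
  { intros [s j]; simpl.
    destruct (classic (exists m, proj1_sig s (j :: nil, m) = o)) as [[m Hm] | n].
    - exists m; intros m' Hm'; destruct (classic (m' = m)); [auto | right; eauto].
    - exists m0; intros m Hm; exfalso; eauto. }
  assert (B : forall (s : code) j, exists a, forall l m, ~ ltM m a ->
      (fun u => proj1_sig s (j :: j :: fst u, snd u)) (l, m) = z).
  { intros [s [a Ha]] j; exists a; simpl; auto. }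
  exists (fun s j => dc (s, j)),
    (fun s j => mkcode (fun u => proj1_sig s (j :: j :: fst u, snd u)) (B s j)).
  intros i c y.
  destruct hK as [trK [irK [triK _]]], hM as [trM [irM _]].
  destruct (strict_bound (fun j : {j | ltK j i} => bd (y (proj1_sig j)))
    (@not_cle_K_below i)) as [a1 H1].
  destruct (strict_bound (fun j : {j | ltK j i} => c (proj1_sig j))
    (@not_cle_K_below i)) as [a2 H2].
  destruct (strict_bound2 a1 a2) as [a3 [H13 H23]].
  destruct (strict_bound2 a3 (c i)) as [a [H3 Hi]].
  (* Lists of length one mark by [o] the column of each stage up to and including [i]. Longer lists
     starting with [j] carry the code of a stage [j] before [i]; their second entry is filler. *)
  set (f := fun u : list K * M => match fst u with
    | nil => z
    | cons j nil => if excluded_middle_informative (~ ltK i j /\ snd u = c j) then o else z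
    | cons j (cons _ l) =>
        if excluded_middle_informative (ltK j i) then proj1_sig (y j) (l, snd u) else z
    end).
  assert (Hf : exists a, forall l m, ~ ltM m a -> f (l, m) = z).
  { exists a; intros [| j [| j' l]] m n; unfold f; simpl; auto;
      destruct (excluded_middle_informative _) as [L |]; auto.
    - exfalso; apply n; destruct L as [nL ->].
      destruct (triK j i) as [L | [-> | L]]; [| auto | tauto].
      apply (trM _ a2); [apply (H2 (exist _ j L)) | eauto].
    - apply bd_spec; intros L'; apply n.
      apply (trM _ (bd (y j))); auto; apply (trM _ a1); [apply (H1 (exist _ j L)) | eauto]. }
  exists (mkcode f Hf); split.
  - intros j nj.
    assert (E : forall m, f (j :: nil, m) = o <-> m = c j).
    { intros m; unfold f; simpl; destruct (excluded_middle_informative _) as [L | L]; [tauto |].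
      split; [intros E; destruct (hzo E) | intros ->; tauto]. }
    destruct (Hdc (mkcode f Hf, j) (c j)) as [H | [m' [n H]]]; simpl in *; auto.
    + apply E; auto.
    + apply E in H; tauto.
  - intros j Lj; simpl; destruct (y j) as [g Hg] eqn:Ey.
    apply subset_eq_compat; extensionality u; destruct u as [l m]; unfold f; simpl.
    destruct (excluded_middle_informative _); [| tauto].
    rewrite Ey; auto.
Qed.

Lemma cle_K_code : cle K code.
Proof.
  destruct hM as [_ [irM _]].
  destruct (strict_bound2 m0 m0) as [a [Ha _]].
  set (f := fun k (u : list K * M) =>
    if excluded_middle_informative (u = (k :: nil, m0)) then o else z).
  assert (Hf : forall k, exists a, forall l m, ~ ltM m a -> f k (l, m) = z).
  { intros k; exists a; intros l m n; unfold f.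
    destruct (excluded_middle_informative _) as [E |]; auto.
    injection E; intros; subst; tauto. }
  exists (fun k => mkcode (f k) (Hf k)); intros k k' E.
  apply (f_equal (fun y => proj1_sig y (k :: nil, m0))) in E; unfold f in E; simpl in E.
  destruct (excluded_middle_informative _); [| tauto].
  destruct (excluded_middle_informative _) as [E' | n]; [| destruct hzo; auto].
  injection E'; auto.
Qed.

Lemma code_q_family (F : ((M -> R) -> Prop) -> Prop) : meagre_cofinal_family K F ->
  exists Q : (code -> (M -> Prop)) -> Prop, q_family Q /\ cle {f | Q f} {A | F A}.
Proof.
  intros HF.
  destruct history_decoder as [dc [dy Hd]], column_chooser as [col Hcol].
  destruct (@choice_on _ (K -> cond -> cond) F (fun A ext =>
    (forall i s, small (dom (ext i s))) /\
    (forall i s, condition s -> condition (ext i s)) /\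
    (forall i s, condition s -> forall p r, s p r -> ext i s p r) /\
    exists N : K -> (M -> R) -> Prop, (forall x, A x -> exists i, N i x) /\
      forall i s, condition s -> forall x, meets (ext i s) x -> ~ N i x) (fun _ s => s))
    as [ext Hext].
  { intros A HA; destruct (kmeagre_indexed (proj1 HF A HA)) as [N [HN cov]].
    destruct (escape_exists N HN) as [ext [E0 [E1 [E2 E3]]]]; exists ext; eauto 8. }
  destruct (choice_fun (fun (v : ((M -> R) -> Prop) * (K -> cond)) u =>
    is_run (ext (fst v)) (snd v) u)) as [run Hrun].
  { intros v; apply run_exists. }
  set (tags := fun (c : K -> M) (y : K -> code) i => tag i (c i) (y i)).
  assert (Ctags : forall c y i, condition (tags c y i)) by (intros; apply tag_condition).
  (* The history [s] supplies codes before stage [i] but columns up to [i] itself; the argument [d]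
     is the code placed at stage [i]. *)
  set (f := fun A i s d =>
    dom (ext A i (join (before i (run (A, tags (dc s) (dy s)))) (tag i (dc s i) d)))).
  exists (fun phi => exists A i s, F A /\ phi = f A i s); split; [split |].
  - intros phi [A [i [s [HA ->]]]] d; exact (proj1 (Hext A HA) i _).
  - intros g sg.
    destruct (proj2 HF (trap col g)) as [A [HA sub]].
    { apply nowhere_dense_kmeagre, trap_nowhere_dense; auto. }
    destruct (Hext A HA) as [_ [E1 [E2 [N [cov E3]]]]].
    apply NNPP; intros n.
    destruct (choice_fun (fun (v : K * code) d =>
      forall p, f A (fst v) (snd v) d p -> g d p)) as [del Hdel].
    { intros [i s]; apply NNPP; intros n'; apply n; exists (f A i s); split; [eauto 6 |].
      intros d Hdd; apply n'; exists d; auto. }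
    destruct (choice_fun (fun (v : K * ((K -> M) * (K -> code))) s =>
      (forall j, ~ ltK (fst v) j -> dc s j = fst (snd v) j) /\
      forall j, ltK j (fst v) -> dy s j = snd (snd v) j)) as [enc Henc].
    { intros [i [c y]]; apply Hd. }
    assert (y0 : code) by (exists (fun _ => z), m0; auto).
    set (nextc := fun i (u : K -> M * code) =>
      col (used g i (fun j => fst (u j)) (fun j => snd (u j)))).
    (* The column of stage [i] is settled before its code, so it belongs to the history given to
       [enc]. Cutting at [i] hides later values and makes the recursion step local. *)
    set (cutc := fun i (u : K -> M * code) j =>
      if excluded_middle_informative (ltK j i) then fst (u j) else nextc i u).
    set (cuty := fun i (u : K -> M * code) j =>
      if excluded_middle_informative (ltK j i) then snd (u j) else y0).
    destruct (@wf_recursion K (M * code) ltK (m0, y0)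
      (fun i u => (nextc i u, del (i, enc (i, (cutc i u, cuty i u)))))) as [u Hu].
    { apply hK. }
    { intros i u v H.
      assert (En : nextc i u = nextc i v).
      { unfold nextc; f_equal; apply used_local; intros j Hj; rewrite H; auto. }
      assert (Ec : cutc i u = cutc i v).
      { extensionality j; unfold cutc; destruct (excluded_middle_informative _);
          rewrite ?H; auto. }
      assert (Ey : cuty i u = cuty i v).
      { extensionality j; unfold cuty; destruct (excluded_middle_informative _);
          rewrite ?H; auto. }
      rewrite En, Ec, Ey; auto. }
    set (c := fun j => fst (u j)); set (y := fun j => snd (u j)).
    assert (Hc : forall i, c i = col (used g i c y)).
    { intros i; unfold c at 1; rewrite Hu; reflexivity. }
    (* The decoded history agrees with the run where stage [i] looks, so the choice of [del]
       confines that stage to [g (y i)]. *)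
    assert (dombound : forall i p, dom (run (A, tags c y) i) p -> g (y i) p).
    { intros i p Hp.
      set (s := enc (i, (cutc i u, cuty i u))).
      assert (Ey : y i = del (i, s)) by (unfold y; rewrite Hu; reflexivity).
      destruct (Henc (i, (cutc i u, cuty i u))) as [Hs1 Hs2]; fold s in Hs1, Hs2.
      simpl in Hs1, Hs2.
      assert (irr : forall k, ~ ltK k k) by apply hK.
      assert (Ec : forall j, ltK j i \/ j = i -> dc s j = c j).
      { intros j Hj; rewrite Hs1.
        - unfold cutc; destruct (excluded_middle_informative _); auto.
          destruct Hj as [Hj | ->]; [tauto | symmetry; apply Hc].
        - destruct hK as [tr _]; intros L; destruct Hj as [Hj | ->]; [| exact (irr _ L)].
          exact (irr _ (tr _ _ _ L Hj)). }
      assert (Eyj : forall j, ltK j i -> dy s j = y j).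
      { intros j Hj; rewrite Hs2; auto; unfold cuty.
        destruct (excluded_middle_informative _); tauto. }
      rewrite Ey; apply (Hdel (i, s)); unfold f; simpl.
      rewrite Ec; auto; rewrite <- Ey.
      rewrite (@run_local (ext A) (tags (dc s) (dy s)) (tags c y)
        (run (A, tags (dc s) (dy s))) (run (A, tags c y)) i).
      - rewrite (Hrun (A, tags c y)) in Hp; exact Hp.
      - apply (Hrun (A, tags (dc s) (dy s))).
      - apply (Hrun (A, tags c y)).
      - intros j Hj; unfold tags; rewrite Ec, Eyj; auto. }
    assert (HR := Hrun (A, tags c y)); simpl in HR.
    destruct (run_limit N E1 E2 E3 HR (Ctags c y)) as [x Hx].
    assert (RC := fun i => run_condition N E1 E2 E3 i HR (Ctags c y)).
    (* Column [c i] avoids every earlier [g (y j)], hence every earlier domain, so the tag of stage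
       [i] enters the run unaltered. *)
    assert (Tx : trap col g x).
    { exists c, y; intros i; split; [apply Hc |].
      intros p r Ht; apply (Hx i); destruct (RC i) as [_ [_ [_ [H _]]]]; apply H; auto.
      intros [r' [j [Hj Hr]]]; destruct Ht as [w [_ [-> _]]].
      apply (@Hcol (used g i c y)) with (u := w).
      - apply used_small; auto.
      - rewrite <- Hc; exists j; split; auto; left; apply dombound; exists r'; auto. }
    destruct (cov x (sub x Tx)) as [i Ni].
    destruct (RC i) as [_ [_ [_ [_ H]]]]; exact (H x (Hx i) Ni).
  (* A member of the family is named by a set [A], a stage and a history; [K] and [code] both embed
     in [F], whose square is no larger than [F]. *)
  - assert (CF := code_cle_family HF).
    assert (KF := cle_trans cle_K_code CF).
    assert (NF := cle_trans (proj1 hreg) KF).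
    apply (@cle_trans _ ({A | F A} * (K * code))).
    + apply (cle_of_rel (fun (phi : {phi | exists A i s, F A /\ phi = f A i s}) v =>
        proj1_sig phi = f (proj1_sig (fst v)) (fst (snd v)) (snd (snd v)))).
      * intros [phi [A [i [s [HA E]]]]]; exists (exist _ A HA, (i, s)); auto.
      * intros [phi H] [phi' H'] v; simpl; intros; apply subset_eq_compat; congruence.
    + apply (cle_trans (cle_prod (cle_refl _)
        (cle_trans (cle_prod KF CF) (cle_square NF)))), cle_square, NF.
Qed.

(** The empty list marks the domain by [o], which recovers its length; the list [k :: nil] stores
    coordinate [k] of the [b]-code of each value. *)
Lemma lessfun_cle_code (L : Type) (b : L -> K -> R) :
  (forall l l', b l = b l' -> l = l') -> cle (lessfun ltM L) code.
Proof.
  intros Hb; destruct hM as [tr [irr [tri _]]].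
  set (f := fun (v : lessfun ltM L) (u : list K * M) =>
    match excluded_middle_informative (ltM (snd u) (projT1 v)) with
    | left H => match fst u with
                | nil => o
                | cons k _ => b (projT2 v (exist _ (snd u) H)) k
                end
    | right _ => z
    end).
  assert (Hf : forall v, exists a, forall l m, ~ ltM m a -> f v (l, m) = z).
  { intros [a v]; exists a; intros l m n; unfold f; simpl.
    destruct (excluded_middle_informative _); tauto. }
  exists (fun v => mkcode (f v) (Hf v)); intros v v' E.
  apply (f_equal (@proj1_sig _ _)) in E; simpl in E.
  destruct v as [a v], v' as [a' v'].
  assert (Ea : forall m, ltM m a <-> ltM m a').
  { intros m; assert (Em := equal_f E (nil, m)); unfold f in Em; simpl in Em.
    destruct (excluded_middle_informative (ltM m a)), (excluded_middle_informative (ltM m a'));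
      try tauto; symmetry in Em; destruct hzo; auto. }
  assert (a = a').
  { destruct (tri a a') as [H | [H | H]]; auto; apply Ea in H; destruct (irr _ H). }
  subst a'; f_equal; extensionality m; destruct m as [m Hm]; apply Hb; extensionality k.
  assert (Em := equal_f E (k :: nil, m)); unfold f in Em; simpl in Em.
  destruct (excluded_middle_informative _) as [H |]; [| tauto].
  rewrite (proof_irrelevance _ Hm H); exact Em.
Qed.
End Coding.

Lemma lessfun_q_family (L : Type) (b : L -> K -> R) (F : ((M -> R) -> Prop) -> Prop) :
  (forall l l', b l = b l' -> l = l') -> meagre_cofinal_family K F ->
  exists Q : (lessfun ltM L -> (M -> Prop)) -> Prop,
    q_family Q /\ cle {f | Q f} {A | F A}.
Proof.
  intros Hb HF.
  destruct column_injection as [e He], cofinal_map as [q Hq].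
  destruct (choice_fun (fun (y : code) a => forall l m, ~ ltM m a -> proj1_sig y (l, m) = z))
    as [bd Hbd].
  { intros [y Hy]; exact Hy. }
  assert (k0 : inhabited K) by (destruct hreg as [[h _] _]; exact (inhabits (h 0))).
  assert (m0 : inhabited M) by (destruct hsing as [[h _] _]; exact (inhabits (h 0))).
  destruct k0 as [k0], m0 as [m0].
  destruct (@code_q_family e q k0 m0 He Hq bd Hbd F HF) as [Q [HQ cQ]].
  destruct (q_family_pull (lessfun_cle_code b Hb) HQ) as [Q' [HQ' cQ']].
  exists Q'; split; [exact HQ' | exact (cle_trans cQ' cQ)].
Qed.
End Topology.
End Cardinals.

Theorem mainTheorem19
  (K M : Type) (ltK : K -> K -> Prop) (ltM : M -> M -> Prop)
  (hK : is_cardinal ltK) (hM : is_cardinal ltM)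
  (hreg : regular_infinite ltK) (hsing : singular ltM) (hcf : cf_is ltM K) :
  (forall F : ((M -> M) -> Prop) -> Prop,
     meagre_cofinal_family K F ->
     exists Q : (lessfun ltM M -> (M -> Prop)) -> Prop,
       q_family Q /\ cle {f | Q f} {A | F A}) /\
  (forall F : ((M -> bool) -> Prop) -> Prop,
     meagre_cofinal_family K F ->
     exists Q : (lessfun ltM K -> (M -> Prop)) -> Prop,
       q_family Q /\ cle {f | Q f} {A | F A}).
Proof.
  split; intros F HF.
  - destruct (proj1 hsing) as [h Hh], (proj1 hreg) as [k _].
    assert (h01 : h 0 <> h 1) by (intros E; apply Hh in E; discriminate).
    (* Over [M] a value is coded by the constant sequence. *)
    apply (lessfun_q_family hK hM hreg hsing hcf h01 (fun m (_ : K) => m)); auto.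
    intros m m' E; exact (equal_f E (k 0)).
  - assert (hft : false <> true) by discriminate.
    (* Over [bool] an element of [K] is coded by the characteristic function of its singleton. *)
    apply (lessfun_q_family hK hM hreg hsing hcf hft
      (fun k k' => if excluded_middle_informative (k = k') then true else false)); auto.
    intros k k' E; apply (f_equal (fun f => f k)) in E; simpl in E.
    destruct (excluded_middle_informative (k = k)); [| tauto].
    destruct (excluded_middle_informative (k' = k)); [auto | discriminate].
Qed.
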